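(* Let $n\geq 2$ and let $D\subset\mathbb{C}^n$ be a bounded convex domain. Then for every $z\in D$, $$v_D(z)\geq \frac{1}{\left(4n\,\operatorname{diam}^2(D)\right)^n}$$ both for $v_D=c_D$ (the Carathéodory-Eisenman volume element) and for $v_D=k_D$ (the Kobayashi-Eisenman volume element), where $\operatorname{diam}(D)$ is the diameter of $D$ and $\operatorname{diam}^2(D)=(\operatorname{diam}(D))^2$.
   Context: A domain is a nonempty connected open set. $\mathbb{B}^n$ is the open unit ball of $\mathbb{C}^n$, $\mathcal{O}(X,Y)$ is the set of holomorphic maps from $X$ to $Y$, and $\det\psi'$ is the complex Jacobian determinant of a holomorphic map $\psi$. The diameter is Euclidean. The Carathéodory and Kobayashi-Eisenman volume elements of a domain $D\subset \mathbb{C}^n$ at $z^0\in D$ are $$c_D(z^0)=\sup\{|\det\psi'(z^0)|^2:\psi\in\mathcal{O}(D,\mathbb{B}^n),\ \psi(z^0)=0\},$$ $$k_D(z^0)=\inf\{|\det\psi'(0)|^{-2}:\psi\in\mathcal{O}(\mathbb{B}^n,D),\ \psi(0)=z^0\}$$ (with $|\det\psi'(0)|^{-2}=+\infty$ if $\det\psi'(0)=0$). *)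

(* Defs.v *)
From HB Require Import structures.
From mathcomp Require Import all_boot all_order all_algebra.
From mathcomp Require Import all_classical all_reals all_analysis.
From mathcomp Require Export complex.

Set Implicit Arguments.
Unset Strict Implicit.
Unset Printing Implicit Defensive.

Import Order.TTheory GRing.Theory Num.Theory.
Import numFieldNormedType.Exports.

Local Open Scope classical_set_scope.
Local Open Scope ring_scope.

(* Gives R[i] its usual topology, with the same structures as those inferred
   for an arbitrary numFieldType. *)
HB.instance Definition _ (R : rcfType) := GRing.ComAlgebra.copy R[i] R[i]^o.
HB.instance Definition _ (R : rcfType) := Vector.copy R[i] R[i]^o.
HB.instance Definition _ (R : rcfType) := NormedModule.copy R[i] R[i]^o.

Section VolumeElements.
Context {R : realType} {n : nat}.
Implicit Types (D X Y : set 'rV[R[i]]_n) (z : 'rV[R[i]]_n)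
  (psi : 'rV[R[i]]_n -> 'rV[R[i]]_n).

(* The library norm on 'rV[R[i]]_n is the maximum norm. *)
Definition euclidean_norm z : R := Num.sqrt (\sum_i Normc.normc (z 0 i) ^+ 2).

Definition unit_ball : set 'rV[R[i]]_n := [set z | euclidean_norm z < 1].

(* Meaningful for nonempty bounded D, since sup is 0 by convention otherwise. *)
Definition diam D : R := sup [set euclidean_norm (x - y) | x in D & y in D].

Definition domain D := [/\ D !=set0, open D & connected D].

(* Differentiability is over the scalar field R[i], i.e. complex Frechet
   differentiability. Maps are total functions; for open X, differentiability
   at points of X and the Jacobian there only depend on psi restricted to X. *)
Definition holomorphic_maps X Y : set ('rV[R[i]]_n -> 'rV[R[i]]_n) :=
  [set psi | (forall z, X z -> differentiable psi z) /\ set_fun X Y psi].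

(* 'J psi z acts on row vectors by right multiplication; it is the transpose of
   the usual complex Jacobian matrix and has the same determinant. *)
Definition jacobian_det psi z : R[i] := \det ('J psi z).

Definition caratheodory_volume D (z0 : 'rV[R[i]]_n) : \bar R :=
  ereal_sup [set (Normc.normc (jacobian_det psi z0) ^+ 2)%:E | psi in
    [set psi | holomorphic_maps D unit_ball psi /\ psi z0 = 0]].

Definition kobayashi_volume D (z0 : 'rV[R[i]]_n) : \bar R :=
  ereal_inf [set (if jacobian_det psi 0 == 0 then +oo%E
                  else (Normc.normc (jacobian_det psi 0) ^- 2)%:E) | psi in
    [set psi | holomorphic_maps unit_ball D psi /\ psi 0 = z0]].

End VolumeElements.

(* Main.v *)
(* Carathéodory: the homothety w |-> (w - z) / (2 diam D) maps D into the unit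
   ball, and its Jacobian determinant is already large enough.

   Kobayashi: let psi map the ball into D with psi 0 = z, and let v be a unit
   eigenvector of the Jacobian at 0 with eigenvalue l. Some coordinate of v
   satisfies n |v_j|^2 >= 1, and h(t) = psi(t v)_j - z_j is holomorphic on the
   unit disc, bounded by diam D, with h(0) = 0 and h'(0) = l v_j. A Cauchy
   estimate |h'(0)| <= 2 diam D then gives |l|^2 <= 4 n diam(D)^2, and the
   determinant is the product of the eigenvalues.

   The Cauchy estimate needs no integral. Contour integrals over squares are
   replaced by midpoint sums with 3^k points per side: these are exact on affine
   functions and additive under subdivision into 3 x 3 squares, so Goursat's
   argument shows that they tend to 0 for a holomorphic function. The
   singularity of h(z)/z^2 at 0 is reached through the chain of central squares,
   and on the square of side 1 centered at 0 the sums for h(z)/z^2 and for 1/z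
   are compared point by point. *)
Require Import Defs.
From mathcomp Require Import all_boot all_order all_algebra.
From mathcomp Require Import all_classical all_reals all_analysis.
From mathcomp Require Import ring lra.
Import Order.TTheory GRing.Theory Num.Theory.
Import numFieldNormedType.Exports.
Import Normc.
Local Open Scope classical_set_scope.
Local Open Scope ring_scope.
Local Open Scope complex_scope.
Local Notation Re := complex.Re.
Local Notation Im := complex.Im.

(** * Midpoint sums over squares *)

Section SquareSums.
Context {R : realType}.
Implicit Types (f g : R[i] -> R[i]) (p d u w z c : R[i]).
Implicit Types (s t e M : R) (k : nat).

Lemma normc_real t : normc (t%:C) = `|t|.
Proof. by rewrite /normc /= expr0n addr0 sqrtr_sqr. Qed.

Lemma normci : normc ('i : R[i]) = 1.
Proof. by rewrite /normc expr0n expr1n add0r sqrtr1. Qed.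

Lemma normc_ge0 z : 0 <= normc z.
Proof. by case: z => a b; exact: sqrtr_ge0. Qed.

Lemma normc_gt0 z : z != 0 -> 0 < normc z.
Proof.
by move=> z0; rewrite lt_neqAle normc_ge0 andbT eq_sym;
  apply: contra z0 => /eqP/eq0_normc->.
Qed.

Lemma sqr_normcE z : normc z ^+ 2 = Re z ^+ 2 + Im z ^+ 2.
Proof. by case: z => a b /=; rewrite sqr_sqrtr// addr_ge0 ?sqr_ge0. Qed.

Lemma ge_Im_normc z : Im z <= normc z.
Proof.
rewrite (le_trans (ler_norm _))// -(@ler_pXn2r _ 2) ?nnegrE ?normc_ge0//.
by rewrite real_normK ?num_real// sqr_normcE lerDr sqr_ge0.
Qed.

Lemma normc_le2 z s : `|Re z| <= s -> `|Im z| <= s -> normc z <= 2 * s.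
Proof.
move=> hr hi; have s0 := le_trans (normr_ge0 _) hr.
rewrite -(@ler_pXn2r _ 2) ?nnegrE ?normc_ge0 ?mulr_ge0// sqr_normcE.
have a : Re z ^+ 2 <= s ^+ 2
  by rewrite -[Re z ^+ 2]real_normK ?num_real// ler_pXn2r ?nnegrE.
have b : Im z ^+ 2 <= s ^+ 2
  by rewrite -[Im z ^+ 2]real_normK ?num_real// ler_pXn2r ?nnegrE.
have := sqr_ge0 s; rewrite exprMn; lra.
Qed.

Lemma Re_realM t z : Re (t%:C * z) = t * Re z.
Proof. by case: z => a b /=; rewrite mul0r subr0. Qed.

Lemma ReD z w : Re (z + w) = Re z + Re w.
Proof. by case: z; case: w. Qed.

Lemma ImD z w : Im (z + w) = Im z + Im w.
Proof. by case: z; case: w. Qed.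

(* Midpoint sum with 3 ^ k nodes for the integral of f over [p, p + d];
   midpoints make it exact on affine functions. *)
Fixpoint seg_sum k f p d : R[i] :=
  if k is k'.+1 then
    seg_sum k' f p (d / 3) + seg_sum k' f (p + d / 3) (d / 3)
      + seg_sum k' f (p + d / 3 + d / 3) (d / 3)
  else d * f (p + d / 2).

Lemma seg_sum_affine k a b p d :
  seg_sum k (fun z => a + b * z) p d = d * (a + b * (p + d / 2)).
Proof.
have two : (2 : R[i]) != 0 by rewrite pnatr_eq0.
have three : (3 : R[i]) != 0 by rewrite pnatr_eq0.
by elim: k p d => [//|k IH] p d /=; rewrite !IH; field.
Qed.

Lemma seg_sum_linear k c f g p d :
  seg_sum k (fun z => c * f z + g z) p d =
  c * seg_sum k f p d + seg_sum k g p d.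
Proof. by elim: k p d => [|k IH] p d /=; rewrite ?IH; ring. Qed.

(** Since [Re] is additive, pointwise domination survives summation. Passing to a third of the
    segment scales both sides of the hypothesis by the same positive real, so the bound with the
    full increment [d] suffices. *)
Lemma seg_sum_le u f g p d k :
  (forall t, 0 <= t <= 1 ->
    normc (d * f (p + t%:C * d)) <= Re (u * (d * g (p + t%:C * d)))) ->
  normc (seg_sum k f p d) <= Re (u * seg_sum k g p d).
Proof.
have third (x : R[i]) : x / 3 = (3^-1 : R)%:C * x
  by rewrite fmorphV rmorph_nat mulrC.
elim: k p d => [|k IH] p d H /=.
  rewrite (_ : d / 2 = (2^-1 : R)%:C * d);
    last by rewrite fmorphV rmorph_nat mulrC.
  by apply: H; lra.
(* Parameter [t] on the third starting at [a / 3] is parameter [(a + t) / 3] on the whole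
   segment. *)
have sub (a : R) : 0 <= a -> a + 1 <= 3 -> forall q, q = p + (a / 3)%:C * d ->
  normc (seg_sum k f q (d / 3)) <= Re (u * seg_sum k g q (d / 3)).
  move=> a0 a2 q ->; apply: IH => t /andP[t0 t1].
  have -> : p + (a / 3)%:C * d + t%:C * (d / 3) = p + ((a + t) / 3)%:C * d.
    rewrite third; rewrite mulrA -rmorphM -addrA -mulrDl -rmorphD.
    by congr (p + _%:C * d); field.
  have := H ((a + t) / 3); set z := p + _ => Hz.
  rewrite third -!mulrA normcM normc_real [u * _]mulrCA Re_realM ger0_norm
    ?invr_ge0//.
  by rewrite ler_pM2l ?invr_gt0//; apply: Hz; apply/andP; split; lra.
rewrite !mulrDr !ReD (le_trans (le_normcD _ _))// lerD//.
  rewrite (le_trans (le_normcD _ _))// lerD//.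
    by apply: (sub 0); rewrite ?mul0r ?addr0//; lra.
  by apply: (sub 1); [lra|lra|rewrite third mul1r].
apply: (sub 2); [lra|lra|].
rewrite third -addrA -mulrDl -rmorphD; congr (p + _%:C * d); by field.
Qed.

(** Comparison with the constant 1, whose sum is exactly [d]. The multiplier
    [u = (M / normc d) * d^*] makes [u * d] the real number [normc d * M]; it is written [1 + 0 * z]
    to fit the affine formula. *)
Lemma normc_seg_sum_le f p d M k :
  (forall t, 0 <= t <= 1 -> normc (f (p + t%:C * d)) <= M) ->
  normc (seg_sum k f p d) <= normc d * M.
Proof.
move=> H.
have dd : d * d^* = (normc d ^+ 2)%:C.
  by rewrite sqr_normcE; case: (d) => a b; apply/eqP; rewrite eq_complex /=;
    apply/andP; split; apply/eqP; ring.
have E : Re ((M / normc d)%:C * d^* * d) = normc d * M.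
  rewrite -mulrA (mulrC d^*) dd -rmorphM /=.
  by have [->|d0] := eqVneq (normc d) 0; [rewrite invr0; ring|field].
have := @seg_sum_le ((M / normc d)%:C * d^*) f (fun z => 1 + 0 * z) p d k.
rewrite seg_sum_affine mul0r addr0 mulr1 E; apply => t t01.
by rewrite mul0r addr0 mulr1 E normcM ler_wpM2l ?normc_ge0 ?H.
Qed.

(* The square has lower left corner p and side s; the sum runs
   counterclockwise. *)
Definition square_sum k f p s : R[i] :=
  seg_sum k f p s%:C + seg_sum k f (p + s%:C) ('i * s%:C)
  - seg_sum k f (p + 'i * s%:C) s%:C - seg_sum k f p ('i * s%:C).

Definition subcorner p s (a b : nat) : R[i] :=
  p + (a%:R * (s / 3))%:C + 'i * (b%:R * (s / 3))%:C.

(** The central cell (1, 1) is kept apart because a singularity may sit in it. *)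
Definition outer_cells : seq (nat * nat) :=
  [:: (0, 0); (0, 1); (0, 2); (1, 0); (1, 2); (2, 0); (2, 1); (2, 2)]%N.

(** Each inner edge is shared by two cells, which traverse it in opposite directions, so only the
    boundary survives. *)
Lemma square_sumS k f p s :
  square_sum k.+1 f p s =
  \sum_(ab <- (1, 1)%N :: outer_cells)
    square_sum k f (subcorner p s ab.1 ab.2) (s / 3).
Proof.
rewrite /square_sum /subcorner /outer_cells /=.
set u := (s / 3)%:C.
have -> : s%:C = u + u + u by rewrite /u -!rmorphD; congr (_%:C); field.
have -> : (u + u + u) / 3 = u by field.
have -> : 'i * (u + u + u) / 3 = 'i * u by field.
rewrite !big_cons big_nil /= !mul0r !mul1r !rmorph0 !mulr0 !addr0.
rewrite -/u (_ : (2 * (s / 3))%:C = u + u); last by rewrite /u -rmorphD;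
  congr (_%:C); ring.
rewrite !mulrDr; set w := 'i * u.
(* Moving [u] before [w] gives each corner a single form, so that [ring] recognizes and cancels the
   shared edges. *)
rewrite !addrA !(addrAC _ w u); ring.
Qed.

Lemma square_sum_affine k a b p s : square_sum k (fun z => a + b * z) p s = 0.
Proof.
have two : (2 : R[i]) != 0 by rewrite pnatr_eq0.
by rewrite /square_sum !seg_sum_affine; field.
Qed.

Lemma square_sum_linear k c f g p s :
  square_sum k (fun z => c * f z + g z) p s =
  c * square_sum k f p s + square_sum k g p s.
Proof. by rewrite /square_sum !seg_sum_linear; ring. Qed.

Definition square p s : set R[i] :=
  [set z | Re p <= Re z <= Re p + s /\ Im p <= Im z <= Im p + s].

Definition frame p s : set R[i] := square p s `&`
  [set z | [\/ Re z = Re p, Re z = Re p + s, Im z = Im p | Im z = Im p + s]].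

(** The bound is required on the boundary only, so a singularity inside the square is allowed. *)
Lemma normc_square_sum_le k f p s M : 0 <= s ->
  (forall z, frame p s z -> normc (f z) <= M) ->
  normc (square_sum k f p s) <= 4 * s * M.
Proof.
move=> s0 H.
have edge q d : normc d = s ->
  (forall t, 0 <= t <= 1 -> frame p s (q + t%:C * d)) ->
  normc (seg_sum k f q d) <= s * M.
  by move=> Es Hd; rewrite -[X in X * M]Es; apply: normc_seg_sum_le => t /Hd;
    exact: H.
have ns : normc s%:C = s by rewrite normc_real ger0_norm.
have nis : normc ('i * s%:C) = s by rewrite normcM normci mul1r.
have -> : 4 * s * M = s * M + s * M + s * M + s * M by ring.
apply: (@le_trans _ _ (normc (seg_sum k f p s%:C)
    + normc (seg_sum k f (p + s%:C) ('i * s%:C))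
    + normc (seg_sum k f (p + 'i * s%:C) s%:C)
    + normc (seg_sum k f p ('i * s%:C)))).
  rewrite (le_trans (le_normcD _ _))// normcN lerD2r.
  by rewrite (le_trans (le_normcD _ _))// normcN lerD2r le_normcD.
rewrite !lerD//; apply: edge => // t /andP[t0 t1];
  have := mulr_ge0 t0 s0; have := ler_wpM2r s0 t1; rewrite mul1r;
    set ts := t * s => h1 h2;
  (split; first split); case: p {H} => a b /=;
    rewrite ?mul0r ?mul1r ?mulr0 ?subr0 ?addr0 ?add0r -/ts;
  try lra; [constructor 3|constructor 2|constructor 4|constructor 1]; lra.
Qed.

Lemma normc_sum_eventually (I : eqType) (r : seq I) (F : I -> nat -> R[i]) e :
  (forall x, x \in r -> exists K, forall k, (K <= k)%N -> normc (F x k) <= e) ->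
  exists K, forall k, (K <= k)%N ->
    normc (\sum_(x <- r) F x k) <= (size r)%:R * e.
Proof.
elim: r => [|x r IH] H; first by exists 0 => k _; rewrite big_nil mul0r normc0.
have [K1 H1] := H x (mem_head _ _).
have [|K2 H2] := IH; first by move=> y yr; apply: H; rewrite inE yr orbT.
exists (maxn K1 K2) => k; rewrite geq_max => /andP[k1 k2].
rewrite big_cons /= -natr1 mulrDl mul1r addrC (le_trans (le_normcD _ _))//.
by rewrite lerD ?H1 ?H2.
Qed.

Definition has_cderiv f w c := forall e, 0 < e -> exists2 r, 0 < r &
  forall z, normc (z - w) < r ->
    normc (f z - f w - c * (z - w)) <= e * normc (z - w).

(* Normalized by the area, so that the same e serves at every subdivision. *)
Definition small_square_sum f p s e :=
  exists K, forall k, (K <= k)%N -> normc (square_sum k f p s) <= e * s ^+ 2.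

Lemma subcorner_square p s ab z : 0 <= s -> (ab.1 <= 2)%N -> (ab.2 <= 2)%N ->
  square (subcorner p s ab.1 ab.2) (s / 3) z -> square p s z.
Proof.
case: ab => a b /= s0 a2 b2; case: p => x y [] /=.
rewrite ?mul0r ?mul1r ?mulr0 ?subr0 ?addr0 ?add0r => h1 h2.
have a2' : a%:R <= 2 :> R by rewrite ler_nat.
have b2' : b%:R <= 2 :> R by rewrite ler_nat.
have ha : 0 <= a%:R * (s / 3) <= 2 * (s / 3)
  by rewrite mulr_ge0 ?ler_wpM2r ?divr_ge0.
have hb : 0 <= b%:R * (s / 3) <= 2 * (s / 3)
  by rewrite mulr_ge0 ?ler_wpM2r ?divr_ge0.
by split => /=; lra.
Qed.

(** The areas of the nine cells add up to the area of the square. *)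
Lemma small_square_sum_subdivide f p s e :
  (forall ab, (ab.1 <= 2)%N -> (ab.2 <= 2)%N ->
     small_square_sum f (subcorner p s ab.1 ab.2) (s / 3) e) ->
  small_square_sum f p s e.
Proof.
move=> H.
have [|K HK] := @normc_sum_eventually _ ((1, 1)%N :: outer_cells)
  (fun ab k => square_sum k f (subcorner p s ab.1 ab.2) (s / 3))
  (e * (s / 3) ^+ 2).
  by move=> ab; rewrite !inE => abl; apply: H; move: abl;
    do ![case/orP|by move/eqP->].
exists K.+1 => -[//|k] kK; rewrite square_sumS (le_trans (HK _ kK))//=.
by rewrite le_eqVlt; apply/orP; left; apply/eqP; field.
Qed.

Lemma squareP p s : 0 <= s -> square p s p.
Proof. by move=> s0; split; lra. Qed.

Lemma square_diam p s z w : square p s z -> square p s w ->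
  normc (z - w) <= 2 * s.
Proof.
case: z; case: w; case: p => p1 p2 w1 w2 z1 z2 [h1 h2] [h3 h4].
by apply: normc_le2; move: h1 h2 h3 h4 => /=; rewrite ler_norml; lra.
Qed.

End SquareSums.

(** * Goursat's argument *)

Section Goursat.
Context {R : realType}.
Implicit Types (f g : R[i] -> R[i]) (p d u w z c : R[i]).
Implicit Types (s t e M : R) (k : nat).

(** The suprema of the coordinates of the lower left corners give the common point: every upper
    right corner bounds all lower left corners, as two squares both contain the smaller one's
    corner. *)
Lemma nested_squares (p : nat -> R[i]) (s : nat -> R) :
  (forall m, 0 <= s m) ->
  (forall m, square (p m.+1) (s m.+1) `<=` square (p m) (s m)) ->
  exists w, forall m, square (p m) (s m) w.
Proof.
move=> s0 H.
have mono m j : (m <= j)%N -> square (p j) (s j) `<=` square (p m) (s m).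
  elim: j => [|j IH]; first by rewrite leqn0 => /eqP->.
  by rewrite leq_eqVlt => /orP[/eqP->//|/IH h x /H]; exact: h.
have corner m j : square (p m) (s m) (p (maxn m j)).
  by apply: (mono _ _ (leq_maxl m j)); apply: squareP.
have cross m j : Re (p j) <= Re (p m) + s m /\ Im (p j) <= Im (p m) + s m.
  have [+ +] := corner m j; have [+ +] := corner j m; rewrite maxnC.
  by move=> h1 h2 h3 h4; split; lra.
pose X := [set Re (p m) | m in setT]; pose Y := [set Im (p m) | m in setT].
have ubX m : ubound X (Re (p m) + s m) by move=> _ [j _ <-]; case: (cross m j).
have ubY m : ubound Y (Im (p m) + s m) by move=> _ [j _ <-]; case: (cross m j).
exists (sup X +i* sup Y) => m; split => /=; apply/andP; split.
- by apply: ub_le_sup; [exists (Re (p 0) + s 0)|exists m].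
- by apply: ge_sup; [exists (Re (p 0)), 0|].
- by apply: ub_le_sup; [exists (Im (p 0) + s 0)|exists m].
- by apply: ge_sup; [exists (Im (p 0)), 0|].
Qed.

Lemma small_side s e : 0 < e -> exists m, s / 3 ^+ m < e.
Proof.
move=> e0; exists (Num.bound (s / e)).
set m := Num.bound _.
have h : s / e < m%:R.
  by have [se|/ltW se] := lerP 0 (s / e);
    [exact: archi_boundP|rewrite (le_lt_trans se)// ltr0n].
rewrite ltr_pdivrMr ?exprn_gt0// mulrC -ltr_pdivrMr// (lt_le_trans h)//.
by rewrite -natrX ler_nat ltnW// ltn_expl.
Qed.

(** A bad square has a bad cell. The resulting nested bad squares shrink to a point [w], near which
    [f] is affine up to a small error, and affine functions have zero sum. *)
Lemma goursat f p s e : 0 <= s -> 0 < e ->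
  (forall w, square p s w -> exists c, has_cderiv f w c) ->
  small_square_sum f p s e.
Proof.
move=> s0 e0 df; apply: contrapT => bad.
(* Badness enters as an implication so that a cell exists for every square; good squares get the
   dummy cell (0, 0). *)
have /choice[phi Hphi] : forall q : R[i] * R, exists ab : nat * nat,
    [/\ (ab.1 <= 2)%N, (ab.2 <= 2)%N & ~ small_square_sum f q.1 q.2 e ->
     ~ small_square_sum f (subcorner q.1 q.2 ab.1 ab.2) (q.2 / 3) e].
  move=> q; apply: contrapT => /forallNP N.
  have [sm|nsm] := pselect (small_square_sum f q.1 q.2 e).
    by apply: (N (0, 0)).
  apply: nsm; apply: small_square_sum_subdivide => ab a2 b2;
    apply: contrapT => nsm.
  by apply: (N ab).
pose next (q : R[i] * R) := (subcorner q.1 q.2 (phi q).1 (phi q).2, q.2 / 3).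
pose Q m := iter m next (p, s).
have Qs m : (Q m).2 = s / 3 ^+ m.
  by elim: m => [|m IH]; rewrite /Q ?divr1//= -/(Q m) IH exprS invfM; ring.
have Qs0 m : 0 <= (Q m).2 by rewrite Qs divr_ge0 ?exprn_ge0.
have sub m : square (Q m.+1).1 (Q m.+1).2 `<=` square (Q m).1 (Q m).2.
  by move=> z; case: (Hphi (Q m)) => a2 b2 _; apply: subcorner_square.
have badQ m : ~ small_square_sum f (Q m).1 (Q m).2 e.
  by elim: m => [//|m IH]; case: (Hphi (Q m)) => _ _; apply.
have [w Hw] := nested_squares (fun m => (Q m).1) (fun m => (Q m).2) Qs0 sub.
have [c Hc] := df w (Hw 0).
(* For a square of side s, perimeter 4s times error (e/8)(2s) is exactly e s^2. *)
have [r r0 Hr] := Hc (e / 8) (divr_gt0 e0 (ltr0Sn _ _)).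
have [m Hm] := small_side s (r / 2) (divr_gt0 r0 (ltr0Sn _ _)).
apply: (badQ m); exists 0 => k _.
pose g z := f z - f w - c * (z - w).
have -> : f = (fun z => 1 * ((f w - c * w) + c * z) + g z)
  by apply/funext => z; rewrite /g; ring.
rewrite square_sum_linear square_sum_affine mulr0 add0r.
have gM := @normc_square_sum_le _ k g (Q m).1 _ (e / 8 * (2 * (Q m).2)) (Qs0 m).
rewrite (le_trans (gM _))//; last lra.
move=> z [/square_diam -/(_ _ (Hw m)) zw _]; rewrite (le_trans (Hr _ _))//.
  by rewrite (le_lt_trans zw)// Qs; lra.
by rewrite ler_pM2l// divr_gt0.
Qed.

(** * Squares centered at an isolated singularity *)

Definition centered_corner (a : R) : R[i] := - a -i* a.

Lemma centered_subcorner a :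
  subcorner (centered_corner a) (2 * a) 1 1 = centered_corner (a / 3).
Proof.
rewrite /subcorner /centered_corner; apply/eqP; rewrite eq_complex /=.
by rewrite ?mul0r ?mul1r ?mulr0 ?subr0 ?addr0 ?add0r; apply/andP; split;
  apply/eqP; field.
Qed.

Lemma frame_centered a z : 0 < a -> frame (centered_corner a) (2 * a) z ->
  a <= normc z <= 2 * a.
Proof.
move=> a0 [[/= h1 h2] h3].
have hn : normc z <= 2 * a by apply: normc_le2; rewrite ler_norml; lra.
rewrite hn andbT -(@ler_pXn2r _ 2) ?nnegrE ?normc_ge0 ?(ltW a0)// sqr_normcE.
have i2 := sqr_ge0 (Im z); have r2 := sqr_ge0 (Re z).
case: h3 => /= e.
- by rewrite {1}e sqrrN lerDl.
- by rewrite {1}e (_ : - a + 2 * a = a) ?lerDl//; ring.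
- by rewrite {1}e sqrrN lerDr.
- by rewrite {1}e (_ : - a + 2 * a = a) ?lerDr//; ring.
Qed.

Lemma square_subcorner0 a ab : 0 < a -> (ab.1 <= 2)%N -> (ab.2 <= 2)%N ->
  ab != (1, 1)%N ->
  ~ square (subcorner (centered_corner a) (2 * a) ab.1 ab.2) (2 * a / 3) 0.
Proof.
by case: ab => [[|[|[|?]]] [|[|[|?]]]]// a0 _ _ _ [] /=;
   rewrite ?mul0r ?mul1r ?mulr0 ?subr0 ?addr0 ?add0r => h1 h2; lra.
Qed.

(** The eight outer cells avoid 0, so Goursat applies to each; every one of them may use an eighth
    of the gap [e' - e]. *)
Lemma square_sum_hole_step f a e e' : 0 < a -> 0 <= e -> e < e' ->
  (forall w, square (centered_corner a) (2 * a) w -> w != 0 ->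
    exists c, has_cderiv f w c) ->
  (exists K, forall k, (K <= k)%N ->
    normc (square_sum k f (centered_corner (a / 3)) (2 * (a / 3))) <= e) ->
  exists K, forall k, (K <= k)%N ->
    normc (square_sum k f (centered_corner a) (2 * a)) <= e'.
Proof.
move=> a0 e0 ee' df [K1 H1].
have a0' : 0 <= 2 * a by rewrite mulr_ge0 ?ltW.
have [|K2 H2] := @normc_sum_eventually _ _ outer_cells
  (fun ab k => square_sum k f (subcorner (centered_corner a) (2 * a) ab.1 ab.2)
    (2 * a / 3)) ((e' - e) / 8).
  move=> ab abl; have [a2 b2 n11] :
    [/\ (ab.1 <= 2)%N, (ab.2 <= 2)%N & ab != (1, 1)%N].
    by move: abl; rewrite !inE; do ![case/orP|by move/eqP->].
  have s0 : 0 < 2 * a / 3 by rewrite divr_gt0 ?mulr_gt0.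
  have [|w sw|K HK] := @goursat f
      (subcorner (centered_corner a) (2 * a) ab.1 ab.2) (2 * a / 3)
      ((e' - e) / 8 / (2 * a / 3) ^+ 2) (ltW s0).
  - by rewrite !divr_gt0 ?subr_gt0 ?exprn_gt0.
  - apply: df; first exact: subcorner_square sw.
    by apply/eqP => w0; apply: (@square_subcorner0 a ab); rewrite -?w0.
  exists K => k /HK; rewrite divfK// expf_neq0// gt_eqF//.
exists (maxn K1 K2).+1 => -[//|k]; rewrite ltnS geq_max => /andP[k1 k2].
rewrite square_sumS big_cons (le_trans (le_normcD _ _))//= centered_subcorner.
have := H1 k k1; have := H2 k k2 => /=; rewrite (_ : 2 * a / 3 = 2 * (a / 3));
  last by ring.
lra.
Qed.

(** The last hypothesis says that f(z) is o(1/|z|) at 0, which beats the perimeter of a tiny central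
    square; the outer cells are then added back scale by scale. *)
Lemma square_sum_hole f a e : 0 < a -> 0 < e ->
  (forall w, square (centered_corner a) (2 * a) w -> w != 0 ->
    exists c, has_cderiv f w c) ->
  (forall e, 0 < e -> exists2 r, 0 < r &
     forall z, z != 0 -> normc z < r -> normc (f z) * normc z <= e) ->
  exists K, forall k, (K <= k)%N ->
    normc (square_sum k f (centered_corner a) (2 * a)) <= e.
Proof.
move=> a0 e0 df f0.
have [r r0 Hr] := f0 (e / 16) (divr_gt0 e0 (ltr0Sn _ _)).
have [m Hm] := small_side a (r / 2) (divr_gt0 r0 (ltr0Sn _ _)).
(* The tiny square costs e/2, and each enlargement loses a little more. Quantifying over every [e']
   above e/2 leaves room for any number of losses. *)
suff: forall e', e / 2 < e' -> exists K, forall k, (K <= k)%N ->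
    normc (square_sum k f (centered_corner a) (2 * a)) <= e' by apply; lra.
elim: m a a0 df Hm => [|m IH] a a0 df Hm e' ee'.
  rewrite expr0 divr1 in Hm.
  (* On the boundary |z| >= a, so |f(z)| |z| <= e/16 gives |f(z)| <= e/(16 a). *)
  exists 0 => k _; apply: (@le_trans _ _ (4 * (2 * a) * (e / 16 / a)));
    last first.
    have -> : 4 * (2 * a) * (e / 16 / a) = e / 2 by field; rewrite gt_eqF.
    exact: ltW.
  apply: normc_square_sum_le => [|z /(frame_centered _ _ a0)/andP[az za]];
    first by rewrite mulr_ge0// ltW.
  have z0 : 0 < normc z := lt_le_trans a0 az.
  rewrite ler_pdivlMr// (le_trans (ler_wpM2l (normc_ge0 _) az))// Hr//;
    last lra.
  by apply: contraTneq z0 => ->; rewrite normc0 ltxx.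
have e2 : 0 <= (e / 2 + e') / 2 by lra.
apply: (@square_sum_hole_step f a ((e / 2 + e') / 2) e') => //; first lra.
apply: IH; [by rewrite divr_gt0| | |lra].
  move=> w sw; apply: df; apply: (@subcorner_square _ _ _ (1, 1)%N);
    rewrite //= ?mulr_ge0 ?ltW//.
  by rewrite centered_subcorner -mulrA.
by move: Hm; rewrite exprS invfM mulrA.
Qed.

(* The condition on u says Re (u * d / z) = 1 / (2 |z|^2), whence the pointwise
   bound |d * h z / z^2| <= 2 M Re (u * d / z). On each side of the square of
   side 1 centered at 0 it holds for u = 'i or u = - 'i. *)
Lemma edge_estimate (h : R[i] -> R[i]) M u p d k : normc d = 1 ->
  (forall t, 0 <= t <= 1 -> let z := p + t%:C * d in
    [/\ normc (h z) <= M, 0 < normc z ^+ 2 <= 1 / 2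
      & Re (u * d * z^* ) = 1 / 2]) ->
  normc (seg_sum k (fun z => h z / z ^+ 2) p d)
    <= 2 * M * Re (u * seg_sum k (fun z => z^-1) p d) /\
  1 <= Re (u * seg_sum k (fun z => z^-1) p d).
Proof.
move=> d1 H.
have key t : 0 <= t <= 1 -> let z := p + t%:C * d in
  Re (u * (d * z^-1)) = (2 * normc z ^+ 2)^-1.
  move=> /H[_ z0 E] z; rewrite -/z in z0 E.
  have -> : u * (d * z^-1) = ((normc z ^+ 2)^-1)%:C * (u * d * z^* ).
    rewrite invc_norm normc_def -sqr_normcE sqrtr_sqr ger0_norm ?normc_ge0//
      fmorphV rmorphXn /=.
    ring.
  rewrite Re_realM E invfM; lra.
split.
  rewrite -Re_realM mulrA; apply: seg_sum_le => t t01.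
  rewrite -mulrA Re_realM key//; have [hM /andP[z0 _] _] := H t t01.
  move: hM z0; set z := p + _ => hM z0.
  rewrite 2!normcM d1 mul1r normcV expr2 normcM -expr2.
  rewrite (_ : 2 * M * _ = M * (normc z ^+ 2)^-1); last by field;
    rewrite -sqrf_eq0 gt_eqF.
  by rewrite ler_pM2r// invr_gt0.
have := @seg_sum_le _ u (fun z => 1 + 0 * z) (fun z => z^-1) p d k.
rewrite seg_sum_affine mul0r addr0 mulr1 d1; apply => t t01.
rewrite mul0r addr0 mulr1 d1 key//; have [_ /andP[z0 z1] _] := H t t01.
by rewrite invf_ge1; lra.
Qed.

End Goursat.

(** * The Cauchy estimate *)

Section CauchyEstimate.
Context {R : realType}.
Implicit Types (f : R[i] -> R[i]).

Lemma norm_normc (z : R[i]) : `|z| = (normc z)%:C.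
Proof. by []. Qed.

(** The norm on [R[i]] takes values in [R[i]], so radii and errors are carried back to [R];
    linearity over [R[i]] turns the differential into multiplication by its value at 1. *)
Lemma differentiable_has_cderiv f w : differentiable f w ->
  has_cderiv f w ('d f w 1).
Proof.
move=> df e e0.
have /eqaddoP H := diff_locally df.
have /H /nbhs_norm0P [r /= r0 Hr] : 0 < e%:C :> R[i] by rewrite ltcR.
have rE : r = (Re r)%:C by rewrite RRe_real// gtr0_real.
exists (Re r); first by rewrite -ltcR -rE.
move=> z zw; have /= := Hr (z - w).
rewrite !fctE /= addrC subrK norm_normc rE ltcR => /(_ zw).
have -> : 'd f w (z - w) = 'd f w 1 * (z - w).
  by rewrite -[in LHS](mulr1 (z - w)) -[_ * 1]/(_ *: _) linearZ mulrC.
by rewrite opprD addrC addrA norm_normc -rmorphM lecR.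
Qed.

Lemma differentiable_quotient (h : R[i] -> R[i]) (c w : R[i]) : w != 0 ->
  differentiable h w ->
  differentiable (fun z : R[i] => h z / z ^+ 2 - c * z^-1) w.
Proof.
move=> w0 dh; pose v : R[i] -> R[i] := fun z => z^-1.
have dV : differentiable v w by exact: differentiable_Rinv.
have -> : (fun z : R[i] => h z / z ^+ 2 - c * z^-1) = (h * (v * v)) - (c *: v)
  :> (R[i] -> R[i]).
  by apply/funext => z; rewrite !fctE /= expr2 invfM.
have d2 : differentiable (v * v) w := differentiableM dV dV.
have d3 : differentiable (h * (v * v)) w := differentiableM dh d2.
have d4 : differentiable (c *: v) w := differentiableZ c dV.
exact: (differentiableB d3 d4).
Qed.

Lemma cauchy_estimate (h : R[i] -> R[i]) (M : R) :
  (forall z, normc z < 1 -> differentiable h z) -> h 0 = 0 ->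
  (forall z, normc z < 1 -> normc (h z) <= M) ->
  normc ('d h 0 1) <= 2 * M.
Proof.
move=> dh h0 hM; set c := 'd h 0 1.
have half0 : 0 < 1 / 2 :> R by lra.
have one : 2 * (1 / 2) = 1 :> R by field.
(* The closed square of side 1 lies in the open unit disc, its corners having modulus sqrt(1/2). *)
have sub (w : R[i]) : square (centered_corner (1 / 2)) (2 * (1 / 2)) w ->
  normc w ^+ 2 <= 1 / 2 /\ normc w < 1.
  case=> /= h1 h2.
  have w2 : normc w ^+ 2 <= 1 / 2 by rewrite sqr_normcE; nra.
  split=> //; rewrite -(@ltr_pXn2r _ 2) ?nnegrE ?normc_ge0//; lra.
(* Subtracting c/z removes the first-order term of [h], which leaves an o(1/|z|) singularity. *)
pose q z := h z / z ^+ 2 - c * z^-1.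
have dq w : square (centered_corner (1 / 2)) (2 * (1 / 2)) w -> w != 0 ->
  exists c, has_cderiv q w c.
  move=> /sub[_ w1] w0; eexists; apply: differentiable_has_cderiv.
  by apply: differentiable_quotient => //; exact: dh.
have q0 e : 0 < e -> exists2 r, 0 < r &
     forall z, z != 0 -> normc z < r -> normc (q z) * normc z <= e.
  move=> e0; have dh0 : differentiable h 0 by apply: dh; rewrite normc0.
  have [r r0 Hr] := differentiable_has_cderiv _ _ dh0 e e0.
  exists r => // z z0 zr; have := Hr z; rewrite !subr0 h0 subr0 => /(_ zr).
  have -> : q z = (h z - c * z) / z ^+ 2 by rewrite /q; field.
  have nz := normc_gt0 _ z0.
  rewrite -ler_pdivrMr// normcM normcV expr2 normcM => le1.
  have -> // : normc (h z - c * z) * (normc z * normc z)^-1 * normc z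
    = normc (h z - c * z) / normc z.
  by field; rewrite gt_eqF.
pose F z := h z / z ^+ 2; pose G (z : R[i]) := z^-1.
pose S f k := square_sum k f (centered_corner (1 / 2)) (2 * (1 / 2)).
have SF k : S F k = c * S G k + S q k.
  rewrite -square_sum_linear; congr square_sum; apply/funext => z;
    rewrite /F /q /G; ring.
(* Each of the four sides contributes at least 1 to the imaginary part; the integral of 1/z itself
   would give 2 pi. *)
have edges k : normc (S F k) <= 2 * M * Im (S G k) /\ 4 <= Im (S G k).
  have E u p d : normc d = 1 ->
     (forall t, 0 <= t <= 1 -> let z := p + t%:C * d in
       frame (centered_corner (1 / 2)) (2 * (1 / 2)) z /\
         Re (u * d * z^* ) = 1 / 2) ->
     normc (seg_sum k F p d) <= 2 * M * Re (u * seg_sum k G p d) /\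
       1 <= Re (u * seg_sum k G p d).
    move=> d1 H; apply: edge_estimate => // t /H[fz Eu].
    have /andP[z0 _] := frame_centered _ _ half0 fz.
    have [z2 z1] := sub _ fz.1; split; [exact: hM| |exact: Eu].
    by rewrite z2 andbT exprn_gt0//; lra.
  have iM (w : R[i]) : Re ('i * w) = - Im w by case: w => x y /=; ring.
  have NiM (w : R[i]) : Re (- 'i * w) = Im w by case: w => x y /=; ring.
  rewrite /S /square_sum one.
  have [|t /andP[t0 t1]|] := E (- 'i) (centered_corner (1 / 2)) 1;
    first by rewrite normc1.
    by split; [split; [split|constructor 3]|] => /=; lra.
  have [|t /andP[t0 t1]|] := E (- 'i) (centered_corner (1 / 2) + 1) ('i * 1);
    first by rewrite mulr1 normci.
    by split; [split; [split|constructor 2]|] => /=; lra.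
  have [|t /andP[t0 t1]|] := E 'i (centered_corner (1 / 2) + 'i * 1) 1;
    first by rewrite normc1.
    by split; [split; [split|constructor 4]|] => /=; lra.
  have [|t /andP[t0 t1]|] := E 'i (centered_corner (1 / 2)) ('i * 1);
    first by rewrite mulr1 normci.
    by split; [split; [split|constructor 1]|] => /=; lra.
  have ImN (w : R[i]) : Im (- w) = - Im w by case: w.
  rewrite !iM !NiM !ImD !ImN => a1 a2 b1 b2 c1 c2 d1 d2; split; last lra.
  rewrite (le_trans (le_normcD _ _))// normcN !mulrDr lerD//.
  rewrite (le_trans (le_normcD _ _))// normcN lerD//.
  by rewrite (le_trans (le_normcD _ _))// lerD.
have [//|Mlt] := leP (normc c) (2 * M).
(* With this tolerance, |c| Im(S G) <= |S F| + |S q| yields (|c| - 2M) Im(S G) <= 2(|c| - 2M),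
   against Im(S G) >= 4. *)
have [K HK] := square_sum_hole q (1 / 2) (2 * (normc c - 2 * M)) half0
  ltac:(lra) dq q0.
have Sq := HK K (leqnn K); have [SFle SGge] := edges K.
have : normc c * normc (S G K) <= normc (S F K) + normc (S q K).
  rewrite -normcM (_ : c * _ = S F K - S q K); last by rewrite SF; ring.
  by rewrite (le_trans (le_normcD _ _))// normcN.
have := ge_Im_normc (S G K); have := normc_ge0 c; rewrite -/(S q K) in Sq; nra.
Qed.

End CauchyEstimate.

(** * Volume elements *)

Lemma diff_coord (K : numFieldType) m n (M : 'M[K]_(m, n)) i j :
  'd (fun N : 'M[K]_(m, n) => N i j : K) M = (fun N => N i j) :> (_ -> _).
Proof.
have @f : {linear 'M[K]_(m, n) -> K}.
  by exists (fun N : 'M[K]_(_, _) => N i j); do 2![eexists]; do ?[constructor];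
     rewrite ?mxE// => ? *; rewrite ?mxE//; move=> ?; rewrite !mxE.
by rewrite (_ : (fun _ => _) = f) // diff_lin//; exact: coord_continuous.
Qed.

(** * Euclidean norm, diameter and eigenvalues of the Jacobian *)

Section EuclideanNorm.
Context {R : realType} {n : nat}.
Implicit Types (x y z v : 'rV[R[i]]_n) (D : set 'rV[R[i]]_n).

Lemma sqr_euclidean_norm z : euclidean_norm z ^+ 2 = \sum_i normc (z 0 i) ^+ 2.
Proof. by rewrite sqr_sqrtr// sumr_ge0// => i _; rewrite sqr_ge0. Qed.

Lemma euclidean_norm_ge0 z : 0 <= euclidean_norm z.
Proof. exact: sqrtr_ge0. Qed.

Lemma euclidean_normZ c z :
  euclidean_norm (c *: z) = normc c * euclidean_norm z.
Proof.
apply/eqP; rewrite -(@eqrXn2 _ 2) ?mulr_ge0 ?euclidean_norm_ge0 ?normc_ge0//.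
rewrite exprMn !sqr_euclidean_norm mulr_sumr; apply/eqP/eq_bigr => i _.
by rewrite mxE normcM exprMn.
Qed.

Lemma euclidean_norm_eq0 z : euclidean_norm z = 0 -> z = 0.
Proof.
move=> z0; have := sqr_euclidean_norm z; rewrite z0 expr0n /= => /esym/eqP.
rewrite psumr_eq0 => [/allP H|i _]; last exact: sqr_ge0.
apply/rowP => i; rewrite mxE; apply: eq0_normc; apply/eqP.
by have := H i; rewrite mem_index_enum sqrf_eq0; apply.
Qed.

Lemma normc_coord_le z i : normc (z 0 i) <= euclidean_norm z.
Proof.
rewrite -(@ler_pXn2r _ 2) ?nnegrE ?normc_ge0 ?euclidean_norm_ge0//.
by rewrite sqr_euclidean_norm (bigD1 i)//= lerDl sumr_ge0// => j _;
  rewrite sqr_ge0.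
Qed.

Lemma normc_coord_le_norm z i : (normc (z 0 i))%:C <= `|z|.
Proof.
rewrite -norm_normc -[leRHS]/(mx_norm z) mx_normE.
rewrite -[leLHS]nngE num_le.
exact: (@le_bigmax _ _ _ _ (fun ij => `|z ij.1 ij.2|%:nng) (0, i)).
Qed.

Lemma euclidean_dist_le_diam D x y : bounded_set D -> D x -> D y ->
  euclidean_norm (x - y) <= diam D.
Proof.
move=> /pinfty_ex_gt0[M M0 HM] Dx Dy.
apply: ub_le_sup; last by exists x => //; exists y.
(* The supremum is meaningful once the distances are bounded; boundedness in the maximum norm bounds
   each coordinate of a difference by 2M. *)
exists (Num.sqrt (n%:R * (2 * Re M) ^+ 2)) => _ [a Da] [b Db] <-.
have ME : M = (Re M)%:C by rewrite RRe_real// gtr0_real.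
have coord (c : 'rV_n) i : D c -> normc (c 0 i) <= Re M.
  by move=> /HM /= cM; rewrite -lecR -ME
    (le_trans (normc_coord_le_norm _ _) cM).
apply: ler_wsqrtr; apply: (@le_trans _ _ (\sum_(i < n) (2 * Re M) ^+ 2)).
  apply: ler_sum => i _; rewrite !mxE ler_sqr ?nnegrE ?normc_ge0//.
    rewrite (le_trans (le_normcD _ _))// normcN.
    by have := coord _ i Da; have := coord _ i Db; lra.
  by have := coord _ i Da; have := normc_ge0 (a 0 i); lra.
by rewrite sumr_const card_ord -[leLHS]mulr_natl.
Qed.

Lemma eigenvalue_bound (psi : 'rV[R[i]]_n -> 'rV[R[i]]_n) (d : R) (l : R[i]) v :
  (forall w, unit_ball w -> differentiable psi w) ->
  (forall w, unit_ball w -> euclidean_norm (psi w - psi 0) <= d) ->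
  v != 0 -> v *m 'J psi 0 = l *: v -> normc l ^+ 2 <= 4 * n%:R * d ^+ 2.
Proof.
move=> dpsi bpsi v0 vl.
wlog v1 : v v0 vl / euclidean_norm v = 1.
  have nv : 0 < euclidean_norm v.
    by rewrite lt_neqAle euclidean_norm_ge0 andbT eq_sym;
      apply: contra v0 => /eqP/euclidean_norm_eq0->.
  move=> H; apply: (H (((euclidean_norm v)^-1)%:C *: v)).
  - by rewrite scaler_eq0 negb_or v0 andbT -(rmorph0 (real_complex R))
      (inj_eq (@complexI R)) invr_eq0 gt_eqF.
  - by rewrite -scalemxAl vl !scalerA mulrC.
  - rewrite euclidean_normZ normc_real ger0_norm ?invr_ge0 ?ltW//.
    by rewrite mulVf// gt_eqF.
(* The n squared moduli add up to 1, so they cannot all be below 1/n. *)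
have [j vj] : exists j, 1 <= n%:R * normc (v 0 j) ^+ 2.
  apply: contrapT => /forallNP H.
  have n0 : (0 < n)%N.
    rewrite lt0n; apply: contra v0 => /eqP n0; apply/eqP/rowP => i.
    by have := leq_ltn_trans (leq0n i) (ltn_ord i); rewrite [X in (_ < X)%N]n0.
  have := sqr_euclidean_norm v; rewrite v1 expr1n => /(congr1 ( *%R n%:R)).
  rewrite mulr1 mulr_sumr => E.
  have : \sum_i n%:R * normc (v 0 i) ^+ 2 < \sum_(i < n) (1 : R).
    apply: ltr_sum; first by apply/hasP; exists (Ordinal n0);
      rewrite ?mem_index_enum.
    by move=> i _; rewrite ltNge; apply/negP/H.
  by rewrite -E sumr_const card_ord ltxx.
have ball0 zeta : normc zeta < 1 -> unit_ball (zeta *: v).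
  by rewrite /unit_ball /= euclidean_normZ v1 mulr1.
pose pj (N : 'rV[R[i]]_n) : R[i] := N 0 j.
pose g (t : R[i]) := t *: v.
pose h : R[i] -> R[i] := (pj \o (psi \o g)) - cst (psi 0 0 j).
have dg (t : R[i]) : is_diff t g g by exact: is_diff_scalel.
have dpg t : normc t < 1 -> differentiable (psi \o g) t.
  by move=> t1; apply: differentiable_comp;
    [exact: ex_diff|exact: dpsi (ball0 _ t1)].
have dpj y : differentiable pj y by exact: differentiable_coord.
have dpjg t : normc t < 1 -> differentiable (pj \o (psi \o g)) t.
  by move=> t1; apply: differentiable_comp (dpg _ t1) (dpj _).
have g0 : g 0 = 0 by rewrite /g scale0r.
have dh0 : 'd h 0 1 = l * v 0 j.
  have n01 : normc (0 : R[i]) < 1 by rewrite normc0.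
  have dpsi0 : differentiable psi (g 0) by rewrite g0; apply: dpsi;
    rewrite -g0; exact: ball0.
  have dg0 : differentiable g 0 by exact: ex_diff.
  (* congr1 instead of rewriting: matching 'd h 0 makes unification diverge. *)
  have E1 : 'd h 0 = 'd (pj \o (psi \o g)) 0 \- 'd (cst (psi 0 0 j)) 0
    :> (_ -> _) :=
    diffB (dpjg _ n01) (differentiable_cst _ _).
  have E2 : 'd (pj \o (psi \o g)) 0 = 'd pj (psi (g 0)) \o 'd (psi \o g) 0
    :> (_ -> _) :=
    diff_comp (dpg _ n01) (dpj _).
  have E3 : 'd (psi \o g) 0 = 'd psi (g 0) \o 'd g 0 :> (_ -> _) :=
    diff_comp dg0 dpsi0.
  have E4 : 'd g 0 = g :> (_ -> _) by rewrite diff_val.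
  have F4 : 'd g 0 1 = v by rewrite E4 /g scale1r.
  (* The differential acts on rows as right multiplication by ['J], so the left eigenvector [v] is
     scaled by [l]. *)
  have F3 : 'd (psi \o g) 0 1 = l *: v.
    have -> : 'd (psi \o g) 0 1 = 'd psi (g 0) ('d g 0 1) :=
      congr1 (fun F : R[i] -> 'rV[R[i]]_n => F 1) E3.
    by rewrite F4 g0 -vl /jacobian mul_rV_lin1.
  have F2 : 'd (pj \o (psi \o g)) 0 1 = l * v 0 j.
    have -> : 'd (pj \o (psi \o g)) 0 1 = 'd pj (psi (g 0)) ('d (psi \o g) 0 1)
      := congr1 (fun F : R[i] -> R[i] => F 1) E2.
    by rewrite F3 diff_coord mxE.
  have F1 : 'd (cst (psi 0 0 j) : R[i] -> R[i]) 0 (1 : R[i]) = 0 :> R[i]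
    by rewrite diff_cst.
  apply: etrans (congr1 (fun F : R[i] -> R[i] => F 1) E1) _.
  apply: etrans (congr2 (fun a b : R[i] => a - b) F2 F1) _.
  exact: subr0.
have := @cauchy_estimate R h d _ _ _.
rewrite dh0 normcM => H.
have le2 : normc l * normc (v 0 j) <= 2 * d.
  apply: H => [t t1||t t1].
  - exact: (differentiableB (dpjg _ t1) (differentiable_cst _ _)).
  - by rewrite /h !fctE /= g0 subrr.
  - rewrite /h !fctE /= (le_trans _ (bpsi _ (ball0 _ t1)))//.
    by rewrite (le_trans _ (normc_coord_le _ j))// !mxE.
have l0 := normc_ge0 l; have vj0 := normc_ge0 (v 0 j).
have sq : (normc l * normc (v 0 j)) ^+ 2 <= (2 * d) ^+ 2.
  by rewrite ler_sqr ?nnegrE ?mulr_ge0//; have := mulr_ge0 l0 vj0; lra.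
have : normc l ^+ 2 * 1 <= normc l ^+ 2 * (n%:R * normc (v 0 j) ^+ 2).
  by rewrite ler_wpM2l ?sqr_ge0.
rewrite mulr1 => /le_trans; apply.
rewrite (_ : _ * _ = n%:R * (normc l * normc (v 0 j)) ^+ 2); last by ring.
rewrite (_ : 4 * _ * _ = n%:R * (2 * d) ^+ 2); last by ring.
by rewrite ler_wpM2l.
Qed.

(** Over the algebraically closed field [R[i]] the characteristic polynomial has n roots with
    multiplicity, all eigenvalues, and its constant coefficient is the determinant up to sign. *)
Lemma det_le_of_eigenvalues (A : 'M[R[i]]_n) (B : R) :
  (forall l v, v != 0 -> v *m A = l *: v -> normc l ^+ 2 <= B) ->
  normc (\det A) ^+ 2 <= B ^+ n.
Proof.
move=> HB.
have [r] := closed_field_poly_normal (char_poly A).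
rewrite (monicP (char_poly_monic A)) scale1r => E.
have sr : size r = n.
  by apply/eqP; rewrite -eqSS -(size_char_poly A) E size_prod_XsubC.
have B0 l : l \in r -> normc l ^+ 2 <= B.
  move=> lr; have /eigenvalueP[v vl v0] : eigenvalue A l.
    by rewrite eigenvalue_root_char E root_prod_XsubC.
  exact: HB v0 vl.
have -> : normc (\det A) = \prod_(l <- r) normc l.
  have := char_poly_det A; rewrite -horner_coef0 E horner_prod =>
    /(congr1 (@normc R)).
  have nN1 : normc ((-1) ^+ n : R[i]) = 1.
    elim: (n) => [|m IH]; first by rewrite expr0 normc1.
    by rewrite exprS normcM IH normcN normc1 mulr1.
  rewrite normcM nN1 mul1r => <-.
  rewrite (big_morph (@normc R) (@normcM R) (@normc1 R)); apply: eq_bigr => l _.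
  by rewrite !hornerE /= ?sub0r normcN.
rewrite -sr -prodrXl; elim: (r) B0 => [|l s IH] H;
  first by rewrite big_nil expr0.
rewrite big_cons [leRHS]exprS ler_pM ?sqr_ge0//.
- by rewrite prodr_ge0// => i _; rewrite sqr_ge0.
- by apply: H; rewrite mem_head.
- by apply: IH => i si; apply: H; rewrite inE si orbT.
Qed.

End EuclideanNorm.

(** * Bounds for the two volume elements *)

Section VolumeBounds.
Context {R : realType} {n : nat}.
Implicit Types (x y z v : 'rV[R[i]]_n) (D : set 'rV[R[i]]_n).

Lemma differentiable_homothety (k : R[i]) z w :
  differentiable (fun x => k *: (x - z)) w.
Proof.
have di : differentiable (id : 'rV[R[i]]_n -> _) w by exact: ex_diff.
exact: (differentiableZ k (differentiableB di (differentiable_cst z w))).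
Qed.

Lemma jacobian_det_homothety (k : R[i]) z w :
  jacobian_det (fun x => k *: (x - z)) w = k ^+ n.
Proof.
rewrite /jacobian_det (_ : 'J _ w = k%:M) ?det_scalar//.
have di : differentiable (id : 'rV[R[i]]_n -> _) w by exact: ex_diff.
have dc := differentiable_cst z w.
have dE : 'd (fun x => k *: (x - z)) w = *:%R k :> (_ -> _).
  apply: etrans (diffZ k (differentiableB di dc)) _; apply/funext => x.
  apply: (congr1 ( *:%R k)).
  have e1 : 'd (id : 'rV[R[i]]_n -> 'rV[R[i]]_n) w x = x by rewrite diff_val.
  have e2 : 'd (cst z : 'rV[R[i]]_n -> 'rV[R[i]]_n) w x = 0 by rewrite diff_cst.
  apply: etrans (congr1 (fun F => F x) (diffB di dc)) _.
  by apply: etrans (congr2 (fun a b => a - b) e1 e2) _; rewrite subr0.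
by apply/matrixP => i j; rewrite mxE dE !mxE eqxx /= mulr_natr eq_sym.
Qed.

Lemma caratheodory_volume_ge D z : bounded_set D -> D z ->
  ((((4 * diam D ^+ 2) ^+ n)^-1)%:E <= caratheodory_volume D z)%E.
Proof.
(* The factor 2 brings the image strictly inside the open ball. *)
move=> bD Dz; pose k := ((2 * diam D)^-1)%:C : R[i].
apply: ereal_sup_ubound; exists (fun x => k *: (x - z)).
  split; last by rewrite subrr scaler0.
  split=> [w _|w Dw]; first exact: differentiable_homothety.
  rewrite /unit_ball /= euclidean_normZ normc_real normfV.
  (* When diam D = 0 the convention 0^-1 = 0 makes the homothety constant. *)
  have wd := euclidean_dist_le_diam _ _ _ bD Dw Dz.
  have [d0|d0] := eqVneq (diam D) 0;
    first by rewrite d0 mulr0 normr0 invr0 mul0r.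
  have d1 : 0 < diam D by rewrite lt_neqAle eq_sym d0
    (le_trans (euclidean_norm_ge0 _) wd).
  rewrite ger0_norm ?mulr_ge0 ?ltW// mulrC ltr_pdivrMr ?mulr_gt0//; lra.
rewrite jacobian_det_homothety /k -rmorphXn normc_real real_normK ?num_real//.
rewrite -exprM mulnC exprM !exprVn (_ : (2 * diam D) ^+ 2 = 4 * diam D ^+ 2)//.
by ring.
Qed.

Lemma kobayashi_volume_ge D z : bounded_set D -> D z ->
  ((((4 * n%:R * diam D ^+ 2) ^+ n)^-1)%:E <= kobayashi_volume D z)%E.
Proof.
move=> bD Dz; apply: le_ereal_inf_tmp => _ [psi [[dpsi psiD] psi0] <-].
case: ifPn => [_|J0]; first exact: leey.
have NJ := normc_gt0 _ J0.
rewrite lee_fin.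
have le : normc (jacobian_det psi 0) ^+ 2 <= (4 * n%:R * diam D ^+ 2) ^+ n.
  apply: det_le_of_eigenvalues => l v v0 vl.
  apply: (eigenvalue_bound psi (diam D) l v dpsi _ v0 vl) => w wB.
  (* Both [psi w] and [psi 0 = z] lie in [D]. *)
  by apply: euclidean_dist_le_diam => //; [exact: psiD|rewrite psi0].
have N2 : 0 < normc (jacobian_det psi 0) ^+ 2 by rewrite exprn_gt0.
by rewrite lef_pV2// posrE (lt_le_trans N2 le).
Qed.

End VolumeBounds.

Theorem corollary1p5 (R : realType) (n : nat) (hn : (2 <= n)%N)
    (D : set 'rV[R[i]]_n) (domD : domain D) (bndD : bounded_set D)
    (cvxD : @convex_set R[i] 'rV[R[i]]_n D) (z : 'rV[R[i]]_n) (Dz : D z) :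
  ((1 / (4 * n%:R * diam D ^+ 2) ^+ n)%:E <= caratheodory_volume D z)%E /\
  ((1 / (4 * n%:R * diam D ^+ 2) ^+ n)%:E <= kobayashi_volume D z)%E.
Proof.
rewrite div1r; split; last exact: kobayashi_volume_ge.
(* The homothety gives a bound without the factor n, which is at least as large as the required one
   because n >= 1. *)
apply: le_trans (caratheodory_volume_ge _ _ bndD Dz); rewrite lee_fin.
have n1 : 1 <= n%:R :> R by rewrite ler1n ltnW.
(* At diameter 0 both sides are the same expression. *)
have [->|d0] := eqVneq (diam D) 0; first by rewrite expr0n !mulr0.
have d2 : 0 < diam D ^+ 2 by rewrite exprn_even_gt0.
have a0 : 0 < 4 * diam D ^+ 2 by rewrite mulr_gt0.
have le : 4 * diam D ^+ 2 <= 4 * n%:R * diam D ^+ 2.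
  by rewrite -mulrA ler_pM2l// ler_peMl// ltW.
have b0 := lt_le_trans a0 le.
by rewrite lef_pV2 ?posrE ?exprn_gt0//; apply: lerXn2r; rewrite // nnegrE ltW.
Qed.
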